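(* Let $(\bar x,\bar y)$ be a local solution to the minimax problem $\min_{x\in X}\max_{y\in\mathcal F(x)}f(x,y)$. Suppose that the solution map $\mathcal S$ is inner semi-continuous at $(\bar x,\bar y)$, that the local error bound holds for the system $g(x,y)\le0$ at $(\bar x,\bar y)$, and that $$\{\nabla_xg(\bar x,\bar y)\lambda:\lambda\in\Sigma^0(\bar x,\bar y)\}=\{0\}.$$ Then there exists $\bar\lambda$ such that $$0\in\nabla_x\mathcal L(\bar x,\bar y,\bar\lambda)+\mathcal N_X(\bar x),\quad\nabla_y\mathcal L(\bar x,\bar y,\bar\lambda)=0,\quad0\le-g(\bar x,\bar y)\perp\bar\lambda\ge0.$$
   Context: $f:\mathbb R^{n+m}\to\mathbb R$ and $g:\mathbb R^{n+m}\to\mathbb R^q$ are continuously differentiable, $X\subseteq\mathbb R^n$ is closed. $\mathcal F(x)=\{y\in\mathbb R^m:g(x,y)\le0\}$, $V(x)=\sup\{f(x,y):y\in\mathcal F(x)\}$ ($=-\infty$ if $\mathcal F(x)=\emptyset$), $\mathcal S(x)=\{y\in\mathcal F(x):f(x,y)=V(x)\}$. $(\bar x,\bar y)$ is a local solution of the minimax problem (in the sense of Stackelberg) if $\bar x\in X$ is a local minimizer of $V$ over $X$ and $\bar y\in\mathcal S(\bar x)$. For a vector-valued map, $\nabla$ is the transposed Jacobian. $\mathcal L(x,y,\lambda)=f(x,y)-g(x,y)^\top\lambda$, and $\Sigma^0(x,y)=\{\lambda:\nabla_yg(x,y)\lambda=0,\ 0\le-g(x,y)\perp\lambda\ge0\}$.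 Inner semi-continuity of $\mathcal S$ at $(\bar x,\bar y)$: for any sequence $x^k\to\bar x$ there exists a sequence $y^k\in\mathcal S(x^k)$ converging to $\bar y$. Local error bound for $g(x,y)\le0$ at $(\bar x,\bar y)$: there are $\kappa,\delta>0$ such that $\mathrm{dist}((x,y),\{(x',y'):g(x',y')\le0\})\le\kappa\sum_{i=1}^q\max\{g_i(x,y),0\}$ for all $(x,y)$ in the ball of radius $\delta$ about $(\bar x,\bar y)$. $\mathcal N_X(\bar x)$ is the limiting normal cone: limits of $\xi^k\in\widehat{\mathcal N}_X(x^k)$ with $x^k\to\bar x$, $x^k\in X$, where $\widehat{\mathcal N}_X(x^* )=\{\xi:\xi^\top(x-x^* )\le o(\|x-x^*\|)\ \forall x\in X\}$. *)

(* Defs.v *)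
From HB Require Import structures.
From mathcomp Require Import all_boot all_order all_algebra.
From mathcomp Require Import all_classical all_reals all_analysis.
Set Implicit Arguments.
Unset Strict Implicit.
Unset Printing Implicit Defensive.
Import Order.TTheory GRing.Theory Num.Theory.
Import numFieldNormedType.Exports.
Local Open Scope classical_set_scope.
Local Open Scope ring_scope.

(* Points of R^n are row vectors ['rV[R]_n], and a pair
   (x, y) of R^n x R^m is [row_mx x y : 'rV[R]_(n + m)]. The library norm on
   matrices is the sup norm: it is only used through the topology, and the
   Euclidean norm [enorm] is used wherever a norm occurs in a formula. *)

Definition dot (R : realType) (n : nat) (u v : 'rV[R]_n) : R :=
  \sum_(i < n) u 0 i * v 0 i.

Definition enorm (R : realType) (n : nat) (u : 'rV[R]_n) : R :=
  Num.sqrt (dot u u).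

(* The distance to the empty set is +oo. *)
Definition edist_to (R : realType) (n : nat) (z : 'rV[R]_n)
    (C : set 'rV[R]_n) : \bar R :=
  ereal_inf [set (enorm (z - w))%:E | w in C].

(* Pointwise continuity of z |-> 'd F z; on R^n this is continuity for the
   operator norm. *)
Definition C1 (R : realType) (n : nat) (W : normedModType R)
    (F : 'rV[R]_n -> W) : Prop :=
  (forall z, differentiable F z) /\
  (forall v, continuous (fun z => 'd F z v)).

Definition gradient (R : realType) (n : nat) (h : 'rV[R]_n -> R)
    (x : 'rV[R]_n) : 'rV[R]_n :=
  \row_(i < n) 'D_(delta_mx 0 i) h x.

(* The library's ['J F x], for F : R^n -> R^q, acts on row vectors from the
   right: it is the n x q matrix of the dF_j/dx_i, i.e. the transposed Jacobian
   usually written as a nabla. *)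
Definition nabla_x (R : realType) (n m q : nat)
    (g : 'rV[R]_(n + m) -> 'rV[R]_q) (x : 'rV[R]_n) (y : 'rV[R]_m)
    : 'M[R]_(n, q) :=
  'J (fun x' : 'rV[R]_n => g (row_mx x' y)) x.

Definition nabla_y (R : realType) (n m q : nat)
    (g : 'rV[R]_(n + m) -> 'rV[R]_q) (x : 'rV[R]_n) (y : 'rV[R]_m)
    : 'M[R]_(m, q) :=
  'J (fun y' : 'rV[R]_m => g (row_mx x y')) y.

Definition feasible (R : realType) (N q : nat) (g : 'rV[R]_N -> 'rV[R]_q)
    : set 'rV[R]_N :=
  [set z | forall i, g z 0 i <= 0].

Definition Fmap (R : realType) (n m q : nat)
    (g : 'rV[R]_(n + m) -> 'rV[R]_q) (x : 'rV[R]_n) : set 'rV[R]_m :=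
  [set y | feasible g (row_mx x y)].

Definition Vfun (R : realType) (n m q : nat) (f : 'rV[R]_(n + m) -> R)
    (g : 'rV[R]_(n + m) -> 'rV[R]_q) (x : 'rV[R]_n) : \bar R :=
  ereal_sup [set (f (row_mx x y))%:E | y in Fmap g x].

Definition Smap (R : realType) (n m q : nat) (f : 'rV[R]_(n + m) -> R)
    (g : 'rV[R]_(n + m) -> 'rV[R]_q) (x : 'rV[R]_n) : set 'rV[R]_m :=
  [set y | Fmap g x y /\ (f (row_mx x y))%:E = Vfun f g x].

Definition local_minimizer (R : realType) (n : nat) (V : 'rV[R]_n -> \bar R)
    (X : set 'rV[R]_n) (xb : 'rV[R]_n) : Prop :=
  X xb /\ (\forall x \near xb, X x -> (V xb <= V x)%E).

Definition minimax_local_solution (R : realType) (n m q : nat)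
    (f : 'rV[R]_(n + m) -> R) (g : 'rV[R]_(n + m) -> 'rV[R]_q)
    (X : set 'rV[R]_n) (xb : 'rV[R]_n) (yb : 'rV[R]_m) : Prop :=
  local_minimizer (Vfun f g) X xb /\ Smap f g xb yb.

Definition inner_semicontinuous (R : realType) (n m : nat)
    (S : 'rV[R]_n -> set 'rV[R]_m) (xb : 'rV[R]_n) (yb : 'rV[R]_m) : Prop :=
  forall u : nat -> 'rV[R]_n, u @ \oo --> xb ->
  exists v : nat -> 'rV[R]_m, (forall k, S (u k) (v k)) /\ v @ \oo --> yb.

Definition local_error_bound (R : realType) (N q : nat)
    (g : 'rV[R]_N -> 'rV[R]_q) (zb : 'rV[R]_N) : Prop :=
  exists kappa delta : R, [/\ 0 < kappa, 0 < delta &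
    forall z : 'rV[R]_N, enorm (z - zb) < delta ->
      (edist_to z (feasible g)
         <= (kappa * \sum_(i < q) Num.max (g z 0 i) 0)%:E)%E].

(* 0 <= a _|_ b >= 0 *)
Definition complementary (R : realType) (q : nat) (a b : 'rV[R]_q) : Prop :=
  [/\ forall i, 0 <= a 0 i, forall i, 0 <= b 0 i & dot a b = 0].

(* [lam *m A^T] is the vector A lam, written as a row. *)
Definition Sigma0 (R : realType) (n m q : nat)
    (g : 'rV[R]_(n + m) -> 'rV[R]_q) (x : 'rV[R]_n) (y : 'rV[R]_m)
    : set 'rV[R]_q :=
  [set lam | lam *m (nabla_y g x y)^T = 0 /\
             complementary (- g (row_mx x y)) lam].

Definition Lagrangian (R : realType) (n m q : nat)
    (f : 'rV[R]_(n + m) -> R) (g : 'rV[R]_(n + m) -> 'rV[R]_q)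
    (x : 'rV[R]_n) (y : 'rV[R]_m) (lam : 'rV[R]_q) : R :=
  f (row_mx x y) - dot (g (row_mx x y)) lam.

Definition regular_normal_cone (R : realType) (n : nat) (X : set 'rV[R]_n)
    (xs : 'rV[R]_n) : set 'rV[R]_n :=
  [set xi | forall eps : R, 0 < eps ->
     \forall x \near xs, X x -> dot xi (x - xs) <= eps * enorm (x - xs)].

Definition limiting_normal_cone (R : realType) (n : nat) (X : set 'rV[R]_n)
    (xb : 'rV[R]_n) : set 'rV[R]_n :=
  [set xi | exists (u w : nat -> 'rV[R]_n),
     [/\ forall k, X (u k), u @ \oo --> xb,
         forall k, regular_normal_cone X (u k) (w k) & w @ \oo --> xi]].

(* Main.v *)
Require Import Defs.
From HB Require Import structures.
From mathcomp Require Import all_boot all_order all_algebra.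
From mathcomp Require Import all_classical all_reals all_analysis.
From mathcomp Require Import ring lra.
Import Order.TTheory GRing.Theory Num.Theory.
Import numFieldNormedType.Exports.
Local Open Scope classical_set_scope.
Local Open Scope ring_scope.

(** Let [V] be the value function and [zb = (xb, yb)].  Three facts give the
    multiplier.

    First, the error bound makes linearized directions usable from every
    feasible point near [zb], not only from [zb]: strict differentiability
    bounds the constraint violation of a step [w] in the linearized cone by
    [o(|w|)], uniformly, and the error bound repairs it at the same price
    ([feasible_step]).  The qualification condition is, by Farkas' lemma, the
    statement that the linearized cone projects onto the whole space of first
    variables ([linearized_cone_lift]).  Both together say that feasible points
    can follow any small displacement of [x] at a linear cost
    ([feasible_aubin]); so the error of a linearized step can be pushed into
    [y], the new abscissa being exactly [x + u] when [w = (u, v)]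
    ([feasible_tangent_step]).

    Second, start such a step from a solution [y] in [S(x)] close to [yb], which
    inner semi-continuity provides.  For every [w = (u, v)] in the cone,
    [V(x + u) >= V(x) + Df(zb) w - o(|w|)], uniformly in [x] near [xb]
    ([value_increase]).  As every [u] is covered by the cone, [V] is Lipschitz
    near [xb] ([value_lipschitz]).

    Third, [xb] minimises a Lipschitz function over [X].  Splitting the variable
    and penalising, that is minimising [V(x') + K|x - x'|^2 + |x - xb|^2] over
    [x] in [X] and [x'] near [xb], and letting [K] grow, produces [p] with
    [- p] in the limiting normal cone of [X] at [xb], where [p] is a limit of
    slopes supporting [V] from below at points [x'] near [xb].  Comparing
    the values of [V] at [x' - t u] and [x'] by the second fact gives
    [Df(zb) w <= p . u] for every [w = (u, v)] in the cone
    ([limiting_critical_point]); the step has to end, not start, at [x'].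
    Farkas' lemma turns this inequality into
    [grad f - (p, 0) = sum_j lam_j grad g_j] with [lam] nonnegative and
    carried by the active constraints, and the two blocks of that equation are
    the two stationarity conditions. *)

Set Implicit Arguments.
Unset Strict Implicit.

(** * Scalar product and norms *)

Section EuclideanStructure.
Context {R : realType}.
Implicit Types n : nat.

Lemma dotC n (u v : 'rV[R]_n) : dot u v = dot v u.
Proof. by apply: eq_bigr => i _; rewrite mulrC. Qed.

Lemma dotDl n (u v w : 'rV[R]_n) : dot (u + v) w = dot u w + dot v w.
Proof. by rewrite -big_split; apply: eq_bigr => i _; rewrite mxE mulrDl. Qed.

Lemma dotZl n (a : R) (u w : 'rV[R]_n) : dot (a *: u) w = a * dot u w.
Proof. by rewrite /dot mulr_sumr; apply: eq_bigr => i _; rewrite mxE mulrA. Qed.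

Lemma dotNl n (u w : 'rV[R]_n) : dot (- u) w = - dot u w.
Proof. by rewrite -scaleN1r dotZl mulN1r. Qed.

Lemma dotBl n (u v w : 'rV[R]_n) : dot (u - v) w = dot u w - dot v w.
Proof. by rewrite dotDl dotNl. Qed.

Lemma dot0l n (w : 'rV[R]_n) : dot 0 w = 0.
Proof. by rewrite -(scale0r 0) dotZl mul0r. Qed.

Lemma dotDr n (u v w : 'rV[R]_n) : dot w (u + v) = dot w u + dot w v.
Proof. by rewrite !(dotC w) dotDl. Qed.

Lemma dotZr n (a : R) (u w : 'rV[R]_n) : dot w (a *: u) = a * dot w u.
Proof. by rewrite !(dotC w) dotZl. Qed.

Lemma dotNr n (u w : 'rV[R]_n) : dot w (- u) = - dot w u.
Proof. by rewrite !(dotC w) dotNl. Qed.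

Lemma dotBr n (u v w : 'rV[R]_n) : dot w (u - v) = dot w u - dot w v.
Proof. by rewrite dotDr dotNr. Qed.

Lemma dot_suml n k (a : 'I_k -> 'rV[R]_n) (w : 'rV[R]_n) :
  dot (\sum_i a i) w = \sum_i dot (a i) w.
Proof.
elim/big_rec2: _ => [|i y x _ <-]; first exact: dot0l.
by rewrite dotDl.
Qed.

Lemma dot_row_mx n m (a u : 'rV[R]_n) (b v : 'rV[R]_m) :
  dot (row_mx a b) (row_mx u v) = dot a u + dot b v.
Proof.
rewrite /dot big_split_ord /=; congr (_ + _); apply: eq_bigr => i _.
  by rewrite !row_mxEl.
by rewrite !row_mxEr.
Qed.

Lemma dot_ge0 n (u : 'rV[R]_n) : 0 <= dot u u.
Proof. by apply: sumr_ge0 => i _; rewrite -expr2 sqr_ge0. Qed.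

Lemma coord_le_norm n (u : 'rV[R]_n) i : `|u 0 i| <= `|u|.
Proof.
rewrite [leRHS]/Num.norm /= mx_normrE.
exact: (le_bigmax _ (fun ij : 'I_1 * 'I_n => `|u ij.1 ij.2|) (0, i)).
Qed.

Lemma norm_le_coord n (u : 'rV[R]_n) (e : R) :
  0 <= e -> (forall i, `|u 0 i| <= e) -> `|u| <= e.
Proof.
move=> e0 ue; rewrite [leLHS]/Num.norm /= mx_normrE; apply/bigmax_leP; split=> //.
by move=> [i j] _ /=; rewrite ord1.
Qed.

Lemma norm_dot_le n (u v : 'rV[R]_n) : `|dot u v| <= n%:R * (`|u| * `|v|).
Proof.
apply: le_trans (ler_norm_sum _ _ _) _.
apply: le_trans (ler_sum _ (G := fun=> `|u| * `|v|) _) _ => [i _|].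
  by rewrite normrM ler_pM ?coord_le_norm.
by rewrite sumr_const card_ord mulr_natl.
Qed.

Lemma dot_eq0 n (u : 'rV[R]_n) : dot u u = 0 -> u = 0.
Proof.
move=> /eqP; rewrite psumr_eq0 => [/allP u0|i _]; last by rewrite -expr2 sqr_ge0.
apply/rowP => i; rewrite mxE.
by have /eqP/eqP := u0 i (mem_index_enum _); rewrite mulf_eq0 orbb => /eqP.
Qed.

Lemma norm_le_enorm n (u : 'rV[R]_n) : `|u| <= enorm u.
Proof.
apply: norm_le_coord => [|i]; first exact: sqrtr_ge0.
rewrite -sqrtr_sqr ler_wsqrtr // /dot (bigD1 i) //= -expr2 lerDl.
by apply: sumr_ge0 => j _; rewrite -expr2 sqr_ge0.
Qed.

Lemma enorm_le_norm n (u : 'rV[R]_n) : enorm u <= n.+1%:R * `|u|.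
Proof.
rewrite -(ger0_norm (mulr_ge0 _ _) : `|n.+1%:R * `|u| | = _) // -sqrtr_sqr.
rewrite ler_wsqrtr //.
apply: le_trans (ler_norm _) _; apply: le_trans (norm_dot_le _ _ ) _.
rewrite exprMn -(expr2 `|u|) ler_wpM2r ?sqr_ge0 // expr2 -natrM ler_nat.
by rewrite (leq_trans (leqnSn n)) // leq_pmulr.
Qed.

Lemma norm_row_mx_le n m (u : 'rV[R]_n) (v : 'rV[R]_m) :
  `|row_mx u v| <= `|u| + `|v|.
Proof.
apply: norm_le_coord => [|i]; first by rewrite addr_ge0.
rewrite -(splitK i); case: (fintype.split i) => j /=.
  by rewrite row_mxEl ler_wpDr ?coord_le_norm.
by rewrite row_mxEr ler_wpDl ?coord_le_norm.
Qed.

Lemma norm_lsubmx_le n m (w : 'rV[R]_(n + m)) : `|lsubmx w| <= `|w|.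
Proof. by apply: norm_le_coord => // i; rewrite mxE coord_le_norm. Qed.

End EuclideanStructure.

(** * Farkas' lemma *)

Section Farkas.
Context {R : realType}.

(** Induction on the number of generators.  If a direction [d] that separates
    [b] from the others fails on [a ord0], then projecting along [a ord0] onto
    the orthogonal of [d] leaves a problem with one generator less; a
    solution or a separating direction for it lifts back. *)
Lemma farkas k N (a : 'I_k -> 'rV[R]_N) (b : 'rV[R]_N) :
  (exists2 l : 'I_k -> R, forall i, 0 <= l i & b = \sum_i l i *: a i) \/
  (exists2 d : 'rV[R]_N, forall i, dot (a i) d <= 0 & 0 < dot b d).
Proof.
elim: k a b => [|k IH] a b.
  have [->|b0] := eqVneq b 0.
    by left; exists (fun=> 0) => [|] //; rewrite big_ord0.
  right; exists b => [[]//|].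
  by rewrite lt_def dot_ge0 andbT; apply: contra_neq b0; exact: dot_eq0.
have [[l l0 bE]|[d ad bd]] := IH (fun i => a (lift ord0 i)) b.
  left; exists (fun i => if unlift ord0 i is Some j then l j else 0).
    by move=> i; case: unlift.
  rewrite big_ord_recl unlift_none scale0r add0r bE.
  by apply: eq_bigr => i _; rewrite liftK.
have [a0d|a0d] := leP (dot (a ord0) d) 0.
  right; exists d => // i.
  by case: (unliftP ord0 i) => [j|] ->.
(* The map pr kills the generator a ord0 and has range orthogonal to d. *)
pose pr (x : 'rV[R]_N) := x - (dot x d / dot (a ord0) d) *: a ord0.
have [[l l0 bE]|[d' ad' bd']] := IH (fun i => pr (a (lift ord0 i))) (pr b).
  left.
  pose c := (dot b d - \sum_i l i * dot (a (lift ord0 i)) d) / dot (a ord0) d.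
  exists (fun i => if unlift ord0 i is Some j then l j else c).
    move=> i; case: unlift => // ; rewrite divr_ge0 ?(ltW a0d) // subr_ge0.
    apply: le_trans (ltW bd); apply: sumr_le0 => j _.
    by rewrite mulr_ge0_le0.
  rewrite big_ord_recl unlift_none.
  under eq_bigr do rewrite liftK.
  have -> : b = \sum_i l i *: pr (a (lift ord0 i))
                + (dot b d / dot (a ord0) d) *: a ord0 by rewrite -bE subrK.
  have -> : \sum_i l i *: pr (a (lift ord0 i)) =
      \sum_i l i *: a (lift ord0 i) -
      (\sum_i l i * (dot (a (lift ord0 i)) d / dot (a ord0) d)) *: a ord0.
    rewrite scaler_suml -sumrB; apply: eq_bigr => i _.
    by rewrite scalerBr scalerA.
  rewrite -addrA addrC; congr (_ + _); rewrite addrC -scalerBl; congr (_ *: _).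
  rewrite /c mulrBl; congr (_ - _).
  by rewrite mulr_suml; apply: eq_bigr => i _; rewrite mulrA.
(* Correcting d' along d makes it orthogonal to a ord0 and dual to pr. *)
right; exists (d' - (dot (a ord0) d' / dot (a ord0) d) *: d).
  have prE x : dot x (d' - (dot (a ord0) d' / dot (a ord0) d) *: d)
             = dot (pr x) d'.
    rewrite dotBr dotZr dotBl dotZl; field; exact: lt0r_neq0.
  move=> i; rewrite prE; case: (unliftP ord0 i) => [j|] -> //.
  by rewrite /pr divff ?lt0r_neq0 // scale1r subrr dot0l.
move: bd'; rewrite dotBr dotZr dotBl dotZl; congr (0 < _).
by field; exact: lt0r_neq0.
Qed.

(** Generators outside [A] are replaced by 0, which is harmless on the dual side
    and leaves their coefficients free to be set to 0. *)
Lemma farkas_on k N (A : pred 'I_k) (a : 'I_k -> 'rV[R]_N) (b : 'rV[R]_N) :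
  (exists l : 'rV[R]_k, [/\ forall i, 0 <= l 0 i, forall i, ~~ A i -> l 0 i = 0
     & b = \sum_i l 0 i *: a i]) \/
  (exists2 d : 'rV[R]_N, forall i, A i -> dot (a i) d <= 0 & 0 < dot b d).
Proof.
have [[l l0 bE]|[d ad bd]] := farkas (fun i => if A i then a i else 0) b.
  left; exists (\row_i if A i then l i else 0); split=> [i|i|].
  - by rewrite mxE; case: ifP.
  - by rewrite mxE => /negbTE->.
  rewrite bE; apply: eq_bigr => i _; rewrite mxE; case: ifP => _ //.
  by rewrite scaler0 scale0r.
by right; exists d => // i Ai; have := ad i; rewrite Ai.
Qed.

End Farkas.

(** * Strict differentiability *)

Section StrictDifferentiability.
Context {R : realType}.

Lemma diff_gradientE N (h : 'rV[R]_N -> R) (z v : 'rV[R]_N) :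
  differentiable h z -> 'd h z v = dot (gradient h z) v.
Proof.
move=> dh; rewrite {1}(row_sum_delta v) linear_sum; apply: eq_bigr => i _.
by rewrite linearZ /= mxE deriveE // mulrC.
Qed.

Lemma C1_coord N q (g : 'rV[R]_N -> 'rV[R]_q) (j : 'I_q) :
  C1 g -> C1 (fun z => g z 0 j).
Proof.
move=> [dg cg].
have dcoord (y : 'rV[R]_q) : differentiable (fun y : 'rV[R]_q => y 0 j) y.
  exact: differentiable_coord.
split=> [z|v]; first exact: (differentiable_comp (dg z) (dcoord (g z))).
have -> : (fun z => 'd (fun z => g z 0 j) z v) = (fun z => 'd g z v 0 j).
  apply/funext => z; rewrite -!deriveE //; last first.
    exact: (differentiable_comp (dg z) (dcoord (g z))).
  by rewrite derive_mx ?mxE //; exact: diff_derivable.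
by move=> z; exact: (continuous_comp (cg v z) (@coord_continuous R 1 q 0 j _)).
Qed.

Lemma gradient_near N (h : 'rV[R]_N -> R) (z0 : 'rV[R]_N) (e : R) :
  C1 h -> 0 < e -> exists2 d, 0 < d &
    forall z, `|z - z0| < d -> `|gradient h z - gradient h z0| <= e.
Proof.
move=> [dh ch] e0.
pose P (i : 'I_N) (z : 'rV[R]_N) :=
  `|'d h z0 (delta_mx 0 i) - 'd h z (delta_mx 0 i)| < e.
have : \forall z \near z0, forall i, P i z.
  apply: (@filter_forall _ _ P (nbhs z0)) => i.
  by have /cvgrPdist_lt /(_ e e0) := ch (delta_mx 0 i) z0.
move=> /nbhs_normP[d /= d0 H]; exists d => // z zd.
apply: norm_le_coord => [|i]; first exact: ltW.
rewrite !mxE !deriveE // distrC ltW //; apply: (H z).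
by rewrite /ball_ /= distrC.
Qed.

(** Both points move: this is what makes the later estimates uniform in the base
    point.  The mean value theorem on the segment from [w] to [z] reduces the
    claim to the continuity of the gradient. *)
Lemma C1_strict N (h : 'rV[R]_N -> R) (z0 : 'rV[R]_N) (e : R) :
  C1 h -> 0 < e -> exists2 d, 0 < d &
    forall z w, `|z - z0| < d -> `|w - z0| < d ->
    `|h z - h w - dot (gradient h z0) (z - w)| <= e * `|z - w|.
Proof.
move=> hC1 e0; have [dh ch] := hC1.
have [d d0 H] := gradient_near z0 hC1 (divr_gt0 e0 (ltr0Sn R N)).
exists d => // z w zd wd.
pose phi (t : R) := h (w + t *: (z - w)).
have dphi (t : R) : is_derive t (1 : R) phi ('d h (w + t *: (z - w)) (z - w)).
  pose l (t : R) : 'rV[R]_N := w + t *: (z - w).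
  have dl : is_diff t l (fun t => t *: (z - w)).
    by apply: is_diff_eq; rewrite add0r.
  have dhl : differentiable (h \o l) t by exact: differentiable_comp.
  have -> : 'd h (l t) (z - w) = 'D_1 phi t.
    by rewrite deriveE // (diff_comp (f := l)) //= diff_val scale1r.
  exact/derivableP/diff_derivable.
have [c c01] : exists2 c, c \in `]0, 1[%R & phi 1 - phi 0
    = 'd h (w + c *: (z - w)) (z - w) * (1 - 0).
  apply: MVT => //.
  apply: continuous_subspaceT => {}x.
  have := @ex_derive _ _ _ _ _ _ _ (dphi x).
  by move/derivable1_diffP/differentiable_continuous.
rewrite /phi scale1r scale0r addr0 (addrC w) subrK subr0 mulr1 => ->.
rewrite diff_gradientE // -dotBl.
apply: le_trans (norm_dot_le _ _) _.
have cd : `|w + c *: (z - w) - z0| < d.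
  move: c01; rewrite in_itv /= => /andP[c0 c1].
  have -> : w + c *: (z - w) - z0 = (1 - c) *: (w - z0) + c *: (z - z0).
    by apply/rowP => i; rewrite !mxE; ring.
  apply: le_lt_trans (ler_normD _ _) _; rewrite !normrZ.
  rewrite !ger0_norm ?subr_ge0 ?ltW //.
  have -> : d = (1 - c) * d + c * d by ring.
  by rewrite ltrD // ltr_pM2l // subr_gt0.
rewrite mulrA ler_wpM2r //.
apply: le_trans (ler_wpM2l _ (H _ cd)) _ => //.
by rewrite mulrCA ler_piMr ?(ltW e0) // ler_pdivrMr // mul1r ler_nat leqnSn.
Qed.

End StrictDifferentiability.

(** * Steps along linearized directions *)

Definition linearized_cone {R : realType} N q (g : 'rV[R]_N -> 'rV[R]_q)
    (zb : 'rV[R]_N) : set 'rV[R]_N :=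
  [set w | forall j, g zb 0 j = 0 ->
                     dot (gradient (fun z => g z 0 j) zb) w <= 0].

Section LocalGeometry.
Context {R : realType}.

Lemma common_radius k (P : 'I_k -> R -> Prop) :
  (forall i, exists2 d, 0 < d & P i d) ->
  (forall i d d', d' <= d -> P i d -> P i d') ->
  exists2 d, 0 < d & forall i, P i d.
Proof.
move=> Pex Pmono; elim: k P Pex Pmono => [|k IH] P Pex Pmono.
  by exists 1 => // -[].
have [d0 d00 Pd0] := Pex ord0.
have [||d1 d10 Pd1] := IH (fun i => P (lift ord0 i)).
- by move=> i; exact: Pex.
- by move=> i; exact: Pmono.
exists (Num.min d0 d1); first by rewrite lt_min d00.
move=> i; case: (unliftP ord0 i) => [j|] ->.
  by apply: Pmono (Pd1 j); rewrite ge_min lexx orbT.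
by apply: Pmono Pd0; rewrite ge_min lexx.
Qed.

(** The distance in the error bound need not be attained; enlarging the constant
    replaces it by an actual point, in the sup norm and for a uniform bound [s]
    on the violations.  The case [s = 0] is apart, as it leaves no room. *)
Lemma error_bound_proj N q (g : 'rV[R]_N -> 'rV[R]_q) (zb : 'rV[R]_N) :
  local_error_bound g zb -> exists k d : R, [/\ 0 < k, 0 < d &
    forall (z : 'rV[R]_N) (s : R), `|z - zb| < d -> 0 <= s ->
      (forall j, g z 0 j <= s) ->
      exists2 w, feasible g w & `|z - w| <= k * s].
Proof.
move=> [kappa [delta [k0 d0 H]]].
exists (kappa * q%:R + 1), (delta / N.+1%:R); split.
- by rewrite ltr_wpDl // mulr_ge0 // ltW.
- by rewrite divr_gt0.
move=> z s zd; rewrite le_eqVlt => /predU1P[<- gz|s0 gz].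
  by exists z => //; rewrite subrr normr0 mulr0.
have zd' : enorm (z - zb) < delta.
  by rewrite (le_lt_trans (enorm_le_norm _)) // mulrC -ltr_pdivlMr.
have sumle : \sum_(i < q) Num.max (g z 0 i) 0 <= q%:R * s.
  rewrite mulr_natl -[X in _ *+ X]card_ord -sumr_const ler_sum // => i _.
  by rewrite ge_max gz ltW.
have lt : (edist_to z (feasible g) < ((kappa * q%:R + 1) * s)%:E)%E.
  apply: (le_lt_trans (H _ zd')); rewrite lte_fin mulrDl mul1r.
  by rewrite ltr_pwDr // -mulrA ler_wpM2l // ltW.
have [_ [w gw <-] wlt] := ereal_inf_lt lt.
by exists w => //; apply: le_trans (norm_le_enorm _) (ltW wlt).
Qed.

Lemma C1_continuous N (h : 'rV[R]_N -> R) : C1 h -> continuous h.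
Proof. by move=> [dh _] z; exact: differentiable_continuous. Qed.

(** An active constraint grows along the step by at most [o(|w|)], an inactive
    one stays negative near [zb]; the error bound then converts the violation
    [o(|w|)] into a feasible point at distance [o(|w|)]. *)
Lemma feasible_step N q (g : 'rV[R]_N -> 'rV[R]_q) (zb : 'rV[R]_N) :
  C1 g -> feasible g zb -> local_error_bound g zb ->
  forall e, 0 < e -> exists2 d, 0 < d & forall z w,
    feasible g z -> `|z - zb| < d -> linearized_cone g zb w -> `|w| < d ->
    exists2 z', feasible g z' & `|z' - (z + w)| <= e * `|w|.
Proof.
move=> gC1 gzb /error_bound_proj[k [d1 [k0 d10 EB]]] e e0.
pose P j d := forall z w,
  feasible g z -> `|z - zb| < d -> linearized_cone g zb w -> `|w| < d ->
  g (z + w) 0 j <= e / k * `|w|.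
have [d2 d20 H] : exists2 d, 0 < d & forall j, P j d.
  apply: common_radius => [j|j d d' dd' Pd z w gz zd wl wd]; last first.
    by apply: Pd => //; [exact: lt_le_trans zd dd'|exact: lt_le_trans wd dd'].
  have gjC1 := C1_coord j gC1.
  have dbl z w d : `|z - zb| < d / 2 -> `|w| < d / 2 -> `|z + w - zb| < d.
    move=> zd wd; rewrite addrAC (splitr d).
    by rewrite (le_lt_trans (ler_normD _ _)) // ltrD.
  have [g0|gN0] := eqVneq (g zb 0 j) 0.
    have [d d0 str] := C1_strict zb gjC1 (divr_gt0 e0 k0).
    exists (d / 2); first by rewrite divr_gt0.
    move=> z w gz zd wl wd.
    have zd' : `|z - zb| < d by
      rewrite (lt_trans zd) // ltr_pdivrMr // ltr_pMr // ltr1n.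
    have := str (z + w) z (dbl _ _ _ zd wd) zd'.
    rewrite (addrC z) addrK => /(le_trans (ler_norm _)).
    have := gz j; have := wl j g0; lra.
  have gneg : g zb 0 j < 0 by rewrite lt_neqAle gN0 gzb.
  have /cvgrPdist_lt/(_ (- g zb 0 j)) := C1_continuous gjC1 (x := zb).
  rewrite oppr_gt0 => /(_ gneg)/nbhs_normP[d /= d0 Hd].
  exists (d / 2); first by rewrite divr_gt0.
  move=> z w gz zd wl wd.
  have := Hd (z + w); rewrite /ball_ /= distrC => /(_ (dbl _ _ _ zd wd)).
  rewrite distrC => /(le_lt_trans (ler_norm _)) lt0.
  apply: (@le_trans _ _ 0); first by lra.
  by rewrite mulr_ge0 // divr_ge0 ?ltW.
exists (Num.min (d1 / 2) d2); first by rewrite lt_min d20 divr_gt0.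
move=> z w gz; rewrite !lt_min => /andP[zd1 zd2] wl /andP[wd1 wd2].
have [|||z' gz' z'E] := EB (z + w) (e / k * `|w|).
- rewrite addrAC (splitr d1).
  by rewrite (le_lt_trans (ler_normD _ _)) // ltrD.
- by rewrite mulr_ge0 // divr_ge0 ?ltW.
- by move=> j; exact: H.
exists z' => //; rewrite distrC (le_trans z'E) // mulrA mulrCA divff ?mulr1 //.
exact: lt0r_neq0.
Qed.

Lemma dist_continuous N (a : 'rV[R]_N) :
  continuous (fun z : 'rV[R]_N => `|z - a|).
Proof.
move=> z; have subC : {for z, continuous (fun y : 'rV[R]_N => y - a)}.
  exact: (cvgB cvg_id (cvg_cst a)).
exact: (continuous_comp subC (@norm_continuous _ _ _)).
Qed.

Lemma closed_feasible N q (g : 'rV[R]_N -> 'rV[R]_q) :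
  C1 g -> closed (feasible g).
Proof.
move=> gC1.
have -> : feasible g =
    \bigcap_(j in [set: 'I_q]) (fun z => g z 0 j) @^-1` [set x | x <= 0].
  by apply/seteqP; split=> [z gz j _|z gz j]; [exact: gz|exact: (gz j I)].
apply: closed_bigI => j _; apply: closed_comp; last exact: closed_le.
by move=> z _; apply: C1_continuous; exact: C1_coord.
Qed.

Lemma compact_closed_ball_inter N (F : set 'rV[R]_N) (zb : 'rV[R]_N) (r : R) :
  closed F -> compact (F `&` [set z | `|z - zb| <= r]).
Proof.
move=> cF; apply: bounded_closed_compact.
  exists (`|zb| + r); split; first exact: num_real.
  move=> M Mlt z [_ /= zr]; apply: ltW; apply: le_lt_trans Mlt.
  by rewrite -(subrK zb z) (le_trans (ler_normD _ _)) // addrC lerD2l.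
apply: closedI => //.
have -> : [set z | `|z - zb| <= r]
    = (fun z => `|z - zb|) @^-1` [set x | x <= r] by [].
apply: closed_comp; last exact: closed_le.
by move=> z _; exact: dist_continuous.
Qed.

(** Instead of iterating the contraction, one minimises over a ball of [F] the
    distance to the target abscissa plus [(4 M)^-1] times the distance to the
    starting point.  If the abscissa of the minimiser missed the target by
    [tau], one more contraction step would lower the first term by [tau / 2] at
    least and raise the second by [tau / 4] at most.  The value at the
    minimiser is at most the value at the starting point, hence the constant
    [4 M]. *)
Lemma aubin_of_contraction n m (F : set 'rV[R]_(n + m)) (zb : 'rV[R]_(n + m))
    (r M : R) :
  closed F -> 0 < r -> 1 <= M ->
  (forall z x, F z -> `|z - zb| < r -> `|x - lsubmx z| < r ->
    exists z1, [/\ F z1, `|x - lsubmx z1| <= 2^-1 * `|x - lsubmx z| &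
                   `|z1 - z| <= M * `|x - lsubmx z| ]) ->
  exists d L, [/\ 0 < d, 0 < L & forall z x,
    F z -> `|z - zb| < d -> `|x - lsubmx zb| < d ->
    exists z', [/\ F z', lsubmx z' = x & `|z' - z| <= L * `|x - lsubmx z| ]].
Proof.
move=> cF r0 M1 step.
have M0 : 0 < M by apply: lt_le_trans M1.
exists (r / (12 * M)), (4 * M); split;
  [by rewrite divr_gt0 ?mulr_gt0|by rewrite mulr_gt0|].
move=> z x Fz zd xd; set d := r / (12 * M) in zd xd.
have dr : 12 * (M * d) = r by rewrite /d; field; exact: lt0r_neq0.
have dMd : d <= M * d by rewrite ler_peMl // ltW // divr_gt0 ?mulr_gt0.
have xzd : `|x - lsubmx z| < 2 * d.
  have -> : x - lsubmx z = (x - lsubmx zb) - lsubmx (z - zb).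
    by rewrite linearB /= opprB addrA subrK.
  rewrite (le_lt_trans (ler_normB _ _)) // mulr2n mulrDl !mul1r ltrD //.
  exact: le_lt_trans (norm_lsubmx_le _) zd.
pose phi (t : 'rV[R]_(n + m)) := `|x - lsubmx t| + (4 * M)^-1 * `|t - z|.
have cphi : continuous phi.
  have c1 : continuous (fun t : 'rV[R]_(n + m) => `|x - lsubmx t|).
    have -> : (fun t : 'rV[R]_(n + m) => `|x - lsubmx t|)
            = (fun y : 'rV[R]_n => `|y - x|) \o lsubmx.
      by apply/funext => t /=; rewrite distrC.
    move=> t; apply: continuous_comp; last exact: dist_continuous.
    exact: continuous_lsubmx.
  move=> t.
  exact: (cvgD (c1 t) (cvgM (cvg_cst (4 * M)^-1) (@dist_continuous _ z t))).
have zK : (F `&` [set t | `|t - zb| <= r]) z by split => //=; lra.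
have [|t] := EVT_min_rV _ (@compact_closed_ball_inter _ F zb r cF)
  (continuous_subspaceT cphi); first by exists z.
rewrite inE => -[Ft _] tmin.
have phit : phi t <= `|x - lsubmx z|.
  have := tmin z; rewrite inE => /(_ zK) /le_trans; apply.
  by rewrite /phi subrr normr0 mulr0 addr0.
have tz : `|t - z| <= 4 * M * `|x - lsubmx z|.
  rewrite -ler_pdivrMl ?mulr_gt0 //; apply: le_trans phit.
  by rewrite /phi lerDr.
exists t; split => //; apply: contrapT => /eqP.
rewrite eq_sym -subr_eq0 -normr_gt0 => tau0.
have xt : `|x - lsubmx t| <= `|x - lsubmx z|.
  by apply: le_trans phit; rewrite lerDl mulr_ge0 // invr_ge0 mulr_ge0 // ltW.
have tzd : `|t - z| <= 8 * (M * d).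
  apply: le_trans tz _.
  have -> : 8 * (M * d) = 4 * M * (2 * d) by ring.
  by rewrite ler_wpM2l // ?mulr_ge0 ?ltW.
have tzb : `|t - zb| <= `|t - z| + `|z - zb|.
  by rewrite -{1}(subrK z t) -addrA ler_normD.
have [| |t1 [Ft1 xt1 tt1]] := step t x Ft; [lra|lra|].
have tt1d : `|t1 - t| <= 2 * (M * d).
  apply: le_trans tt1 _; rewrite mulrCA ler_wpM2l ?ltW //.
  by rewrite (le_lt_trans xt).
have t1zb : `|t1 - zb| <= `|t1 - t| + `|t - zb|.
  by rewrite -{1}(subrK t t1) -addrA ler_normD.
have t1K : (F `&` [set t | `|t - zb| <= r]) t1 by split => //=; lra.
have := tmin t1; rewrite inE => /(_ t1K); apply/negP; rewrite -ltNge /phi.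
have t1z : `|t1 - z| <= M * `|x - lsubmx t| + `|t - z|.
  by rewrite -(subrK t t1) -addrA (le_trans (ler_normD _ _)) // lerD2r.
have : (4 * M)^-1 * `|t1 - z| <= 4^-1 * `|x - lsubmx t| + (4 * M)^-1 * `|t - z|.
  have -> : 4^-1 * `|x - lsubmx t| = (4 * M)^-1 * (M * `|x - lsubmx t|).
    by field; exact: lt0r_neq0.
  by rewrite -mulrDr ler_wpM2l // invr_ge0 mulr_ge0 // ltW.
lra.
Qed.

End LocalGeometry.

(** * Partial gradients and lifting of directions *)

Section Multipliers.
Context {R : realType}.

Lemma gradient_lsub n m (h : 'rV[R]_(n + m) -> R) x y :
  gradient (fun x' => h (row_mx x' y)) x = lsubmx (gradient h (row_mx x y)).
Proof.
apply/rowP => i; rewrite !mxE.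
have dE : delta_mx 0 (lshift m i) = row_mx (delta_mx 0 i) 0 :> 'rV[R]_(n + m).
  apply/rowP => j; rewrite -(splitK j); case: (fintype.split j) => k /=.
    by rewrite row_mxEl !mxE eqxx /= (inj_eq (@lshift_inj _ _)).
  by rewrite row_mxEr !mxE eqxx /= eq_rlshift.
rewrite /derive; apply: (congr1 (fun F : R -> R => lim (F @ 0^'))).
apply/funext => t /=.
by rewrite dE scale_row_mx add_row_mx scaler0 add0r.
Qed.

Lemma gradient_rsub n m (h : 'rV[R]_(n + m) -> R) x y :
  gradient (fun y' => h (row_mx x y')) y = rsubmx (gradient h (row_mx x y)).
Proof.
apply/rowP => i; rewrite !mxE.
have dE : delta_mx 0 (rshift n i) = row_mx 0 (delta_mx 0 i) :> 'rV[R]_(n + m).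
  apply/rowP => j; rewrite -(splitK j); case: (fintype.split j) => k /=.
    by rewrite row_mxEl !mxE eqxx /= eq_lrshift.
  by rewrite row_mxEr !mxE eqxx /= (inj_eq (@rshift_inj _ _)).
rewrite /derive; apply: (congr1 (fun F : R -> R => lim (F @ 0^'))).
apply/funext => t /=.
by rewrite dE scale_row_mx add_row_mx scaler0 add0r.
Qed.

Lemma differentiable_row_mxl n m (y : 'rV[R]_m) (x : 'rV[R]_n) :
  differentiable (fun x' : 'rV[R]_n => row_mx x' y) x.
Proof.
pose l := mulmxr (row_mx 1%:M 0 : 'M[R]_(n, n + m))
  : 'rV[R]_n -> 'rV[R]_(n + m).
have lE u : l u = row_mx u 0 by rewrite /l /= mul_mx_row mulmx1 mulmx0.
have cl : continuous l.
  move=> u A /nbhs_normP[e /= e0 eA].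
  apply/(nbhs_normP u (l @^-1` A)); exists e => // z /= zu; apply: eA => /=.
  rewrite !lE opp_row_mx add_row_mx oppr0 addr0.
  by rewrite (le_lt_trans (norm_row_mx_le _ _)) // normr0 addr0.
have lcE : l + cst (row_mx 0 y) = (fun x' : 'rV[R]_n => row_mx x' y).
  by apply/funext => x' /=; rewrite !fctE lE add_row_mx addr0 add0r.
have : differentiable (l + cst (row_mx 0 y)) x.
  by apply: differentiableD; first exact: linear_differentiable.
by rewrite lcE.
Qed.

Lemma differentiable_row_mxr n m (y : 'rV[R]_m) (x : 'rV[R]_n) :
  differentiable (fun y' : 'rV[R]_m => row_mx x y') y.
Proof.
pose l := mulmxr (row_mx 0 1%:M : 'M[R]_(m, n + m))
  : 'rV[R]_m -> 'rV[R]_(n + m).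
have lE u : l u = row_mx 0 u by rewrite /l /= mul_mx_row mulmx1 mulmx0.
have cl : continuous l.
  move=> u A /nbhs_normP[e /= e0 eA].
  apply/(nbhs_normP u (l @^-1` A)); exists e => // z /= zu; apply: eA => /=.
  rewrite !lE opp_row_mx add_row_mx oppr0 addr0.
  by rewrite (le_lt_trans (norm_row_mx_le _ _)) // normr0 add0r.
have lcE : l + cst (row_mx x 0) = (fun y' : 'rV[R]_m => row_mx x y').
  by apply/funext => x' /=; rewrite !fctE lE add_row_mx addr0 add0r.
have : differentiable (l + cst (row_mx x 0)) y.
  by apply: differentiableD; first exact: linear_differentiable.
by rewrite lcE.
Qed.

Lemma jacobianE n q (F : 'rV[R]_n -> 'rV[R]_q) x i j :
  differentiable F x -> 'J F x i j = gradient (fun z => F z 0 j) x 0 i.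
Proof.
move=> dF; rewrite !mxE -deriveE // derive_mx ?mxE //.
exact: diff_derivable.
Qed.

Lemma nabla_xE n m q (g : 'rV[R]_(n + m) -> 'rV[R]_q) x y (lam : 'rV[R]_q) :
  C1 g -> lam *m (nabla_x g x y)^T =
  lsubmx (\sum_j lam 0 j *: gradient (fun z => g z 0 j) (row_mx x y)).
Proof.
move=> [dg _]; rewrite linear_sum; apply/rowP => i; rewrite mxE summxE.
apply: eq_bigr => j _; rewrite linearZ /= mxE [in RHS]mxE; congr (_ * _).
rewrite jacobianE; first by rewrite (gradient_lsub (fun z => g z 0 j)).
by apply: differentiable_comp => //; exact: differentiable_row_mxl.
Qed.

Lemma nabla_yE n m q (g : 'rV[R]_(n + m) -> 'rV[R]_q) x y (lam : 'rV[R]_q) :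
  C1 g -> lam *m (nabla_y g x y)^T =
  rsubmx (\sum_j lam 0 j *: gradient (fun z => g z 0 j) (row_mx x y)).
Proof.
move=> [dg _]; rewrite linear_sum; apply/rowP => i; rewrite mxE summxE.
apply: eq_bigr => j _; rewrite linearZ /= mxE [in RHS]mxE; congr (_ * _).
rewrite jacobianE; first by rewrite (gradient_rsub (fun z => g z 0 j)).
by apply: differentiable_comp => //; exact: differentiable_row_mxr.
Qed.

Lemma complementary_active q (a lam : 'rV[R]_q) :
  (forall j, a 0 j <= 0) -> (forall j, 0 <= lam 0 j) ->
  (forall j, a 0 j != 0 -> lam 0 j = 0) -> complementary (- a) lam.
Proof.
move=> a0 l0 la; split=> // [j|]; first by rewrite mxE oppr_ge0.
apply: big1 => j _; rewrite mxE; have [->|/la->] := eqVneq (a 0 j) 0.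
  by rewrite oppr0 mul0r.
by rewrite mulr0.
Qed.

(** The dual form of the qualification condition.  The unknown [v] has to satisfy
    the inhomogeneous system [grad_y g_j . v <= - grad_x g_j . u] over the active
    [j]; it is homogenised with one more coordinate, so that the Farkas
    alternative is a [lam] in [Sigma0] with [(nabla_x g lam) . u = 1], which the
    condition excludes. *)
Lemma linearized_cone_lift n m q (g : 'rV[R]_(n + m) -> 'rV[R]_q) xb yb u :
  C1 g -> feasible g (row_mx xb yb) ->
  [set lam *m (nabla_x g xb yb)^T | lam in Sigma0 g xb yb] = [set 0] ->
  exists v, linearized_cone g (row_mx xb yb) (row_mx u v).
Proof.
move=> gC1 gzb CQ; set zb := row_mx xb yb in gzb *.
pose a j := gradient (fun z => g z 0 j) zb.
have [[l [l0 lA]]|[d ad]] := farkas_on (fun j => g zb 0 j == 0)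
    (fun j => row_mx (rsubmx (a j)) (dot (lsubmx (a j)) u)%:M : 'rV_(m + 1))
    (row_mx 0 1).
  pose S := \sum_j l 0 j *: a j.
  have -> : \sum_j l 0 j *: row_mx (rsubmx (a j)) (dot (lsubmx (a j)) u)%:M
          = row_mx (rsubmx S) (dot (lsubmx S) u)%:M :> 'rV_(m + 1).
    rewrite -[LHS]hsubmxK; congr row_mx; rewrite /S !linear_sum /=.
      by apply: eq_bigr => j _; rewrite !linearZ /= row_mxKl.
    apply/rowP => i; rewrite (ord1 i) summxE mxE mulr1n dot_suml.
    apply: eq_bigr => j _.
    by rewrite !linearZ /= row_mxKr dotZl !mxE mulr1n.
  move=> /eq_row_mx[Sy /rowP/(_ 0)]; rewrite !mxE eqxx !mulr1n => Sx.
  have lS : Sigma0 g xb yb l.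
    by split; [rewrite nabla_yE // -Sy|exact: complementary_active].
  have : [set 0] (l *m (nabla_x g xb yb)^T) by rewrite -CQ; exists l.
  rewrite nabla_xE //= -/S => Sx0; move: Sx; rewrite Sx0 dot0l => /eqP.
  by rewrite oner_eq0.
rewrite -(hsubmxK d) dot_row_mx dot0l add0r.
rewrite {1}/dot big_ord1 mxE eqxx mul1r; set s := rsubmx d 0 0 => s0.
exists (s^-1 *: lsubmx d) => j gj0.
have := ad j; rewrite -{1}(hsubmxK d) gj0 eqxx dot_row_mx => /(_ isT).
rewrite {2}/dot big_ord1 mxE eqxx mulr1n -/s -/(a j) => H.
rewrite -(hsubmxK (a j)) dot_row_mx dotZr.
rewrite -(@ler_pM2l _ s) // mulr0 mulrDr mulrA divff ?lt0r_neq0 // mul1r.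
by rewrite addrC (mulrC s).
Qed.

Lemma linearized_coneP N q (g : 'rV[R]_N -> 'rV[R]_q) zb k
    (c : 'I_k -> R) (w : 'I_k -> 'rV[R]_N) :
  (forall i, 0 <= c i) -> (forall i, linearized_cone g zb (w i)) ->
  linearized_cone g zb (\sum_i c i *: w i).
Proof.
move=> c0 wl j gj; rewrite dotC dot_suml; apply: sumr_le0 => i _.
by rewrite dotZl dotC mulr_ge0_le0 // wl.
Qed.

(** Lifting the vectors [e_i] and [- e_i] once and for all and combining them
    conically makes the size of the lift linear in [u]. *)
Lemma linearized_cone_lift_bounded n m q
    (g : 'rV[R]_(n + m) -> 'rV[R]_q) xb yb :
  C1 g -> feasible g (row_mx xb yb) ->
  [set lam *m (nabla_x g xb yb)^T | lam in Sigma0 g xb yb] = [set 0] ->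
  exists2 C, 1 <= C & forall u : 'rV[R]_n,
    exists2 w, linearized_cone g (row_mx xb yb) w &
               lsubmx w = u /\ `|w| <= C * `|u|.
Proof.
move=> gC1 gzb CQ.
have /choice[V VP] : forall k : 'I_n * bool, exists v : 'rV[R]_m,
    linearized_cone g (row_mx xb yb)
      (row_mx ((-1) ^+ k.2 *: delta_mx 0 k.1) v).
  by move=> k; exact: linearized_cone_lift.
pose W (k : 'I_n * bool) := row_mx ((-1) ^+ k.2 *: delta_mx 0 k.1) (V k).
exists (1 + \sum_i (`|W (i, true)| + `|W (i, false)|)).
  by rewrite lerDl sumr_ge0 // => i _; rewrite addr_ge0.
move=> u; pose s i := u 0 i < 0.
exists (\sum_i `|u 0 i| *: W (i, s i)).
  by apply: linearized_coneP => // i; exact: VP.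
split.
  rewrite linear_sum [RHS]row_sum_delta; apply: eq_bigr => i _.
  rewrite linearZ /= row_mxKl scalerA /s; congr (_ *: _).
  by case: ltP => [/ltr0_norm->|/ger0_norm->]; rewrite ?expr1 ?mulrNN ?expr0 mulr1.
apply: le_trans (ler_norm_sum _ _ _) _.
rewrite mulrDl mul1r ler_wpDl // mulr_suml; apply: ler_sum => i _.
rewrite normrZ normr_id mulrC ler_pM ?coord_le_norm //.
by case: (s i); rewrite ?lerDl ?lerDr.
Qed.

End Multipliers.

(** * Stability of the feasible set *)

Section FeasibleMap.
Context {R : realType} {n m q : nat}.
Context {g : 'rV[R]_(n + m) -> 'rV[R]_q} {xb : 'rV[R]_n} {yb : 'rV[R]_m}.
Context (gC1 : C1 g).
Context (gzb : feasible g (row_mx xb yb)).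
Context (leb : local_error_bound g (row_mx xb yb)).
Context (CQ :
  [set lam *m (nabla_x g xb yb)^T | lam in Sigma0 g xb yb] = [set 0]).
Local Notation zb := (row_mx xb yb).

(** Lifted directions of size at most [C] times their abscissa, followed with
    relative error [1 / (2 C)], halve the distance to the target abscissa. *)
Lemma feasible_aubin : exists d L, [/\ 0 < d, 0 < L & forall z x,
  feasible g z -> `|z - zb| < d -> `|x - xb| < d ->
  exists z', [/\ feasible g z', lsubmx z' = x &
                 `|z' - z| <= L * `|x - lsubmx z| ]].
Proof.
have [C C1' lift] := linearized_cone_lift_bounded gC1 gzb CQ.
have C0 : 0 < C by apply: lt_le_trans C1'.
have e0 : 0 < (2 * C)^-1 by rewrite invr_gt0 mulr_gt0.
have [d d0 stepE] := feasible_step gC1 gzb leb e0.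
have M1 : 1 <= 2 * C by lra.
have := @aubin_of_contraction _ _ _ (feasible g) zb (d / C) (2 * C)
  (closed_feasible gC1) (divr_gt0 d0 C0) M1.
rewrite row_mxKl; apply=> z x gz zd xd.
have dC : d / C <= d by rewrite ler_pdivrMr // ler_peMr // ltW.
have [w wl [wx wC]] := lift (x - lsubmx z).
have wd : `|w| < d by rewrite (le_lt_trans wC) // mulrC -ltr_pdivlMr.
have [z1 gz1 z1E] := stepE z w gz (lt_le_trans zd dC) wl wd.
have z1E' : `|z1 - (z + w)| <= 2^-1 * `|x - lsubmx z|.
  rewrite (le_trans z1E) // invfM -mulrA ler_pM2l // ler_pdivrMl //.
exists z1; split=> //.
  rewrite (le_trans _ z1E') // distrC.
  have -> : lsubmx z1 - x = lsubmx (z1 - (z + w)).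
    by rewrite linearB linearD /= wx addrC (addrC (lsubmx z)) subrK addrC.
  exact: norm_lsubmx_le.
have -> : z1 - z = (z1 - (z + w)) + w by rewrite opprD addrA subrK.
rewrite (le_trans (ler_normD _ _)) //.
have : 1 * `|x - lsubmx z| <= C * `|x - lsubmx z| by rewrite ler_wpM2r.
by have := normr_ge0 (x - lsubmx z); lra.
Qed.

(** The step of [feasible_step] misses the abscissa by [o(|w|)], and
    [feasible_aubin] corrects this at a cost of the same order.  Hitting the
    abscissa exactly is what allows a comparison of values of [V]. *)
Lemma feasible_tangent_step e : 0 < e -> exists2 d, 0 < d & forall z w,
  feasible g z -> `|z - zb| < d -> linearized_cone g zb w -> `|w| < d ->
  exists z', [/\ feasible g z', lsubmx z' = lsubmx z + lsubmx w &
                 `|z' - (z + w)| <= e * `|w| ].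
Proof.
move=> e0; have [dA [L [dA0 L0 aubin]]] := feasible_aubin.
pose e1 := Num.min 1 (e / (1 + L)).
have L1 : 0 < 1 + L by rewrite addr_gt0.
have e10 : 0 < e1 by rewrite lt_min ltr01 divr_gt0.
have e11 : e1 <= 1 by rewrite ge_min lexx.
have e1e : e1 * (1 + L) <= e.
  by rewrite -ler_pdivlMr // ge_min lexx orbT.
have [dS dS0 stepE] := feasible_step gC1 gzb leb e10.
exists (Num.min (dA / 3) dS); first by rewrite lt_min dS0 divr_gt0.
move=> z w gz; rewrite !lt_min => /andP[zdA zdS] wl /andP[wdA wdS].
have [z1 gz1 z1E] := stepE z w gz zdS wl wdS.
have zwE : `|z + w - zb| <= `|z - zb| + `|w| by rewrite addrAC ler_normD.
have z1w : `|z1 - (z + w)| <= `|w|.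
  by rewrite (le_trans z1E) // ler_piMl.
have z1d : `|z1 - zb| < dA.
  have -> : z1 - zb = (z1 - (z + w)) + (z + w - zb) by rewrite addrA subrK.
  rewrite (le_lt_trans (ler_normD _ _)) //; lra.
have xd : `|lsubmx (z + w) - xb| < dA.
  have -> : lsubmx (z + w) - xb = lsubmx (z + w - zb).
    by rewrite linearB /= row_mxKl.
  rewrite (le_lt_trans (norm_lsubmx_le _)) //; lra.
have [z' [gz' z'x z'E]] := aubin z1 _ gz1 z1d xd.
exists z'; split=> //; first by rewrite z'x linearD.
have xE : `|lsubmx (z + w) - lsubmx z1| <= e1 * `|w|.
  rewrite distrC (le_trans _ z1E) //.
  by rewrite -linearB norm_lsubmx_le.
have -> : z' - (z + w) = (z' - z1) + (z1 - (z + w)) by rewrite addrA subrK.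
rewrite (le_trans (ler_normD _ _)) //.
have h1 : L * `|lsubmx (z + w) - lsubmx z1| <= L * (e1 * `|w|).
  by rewrite ler_pM2l.
have h2 : e1 * (1 + L) * `|w| <= e * `|w| by rewrite ler_wpM2r.
lra.
Qed.

End FeasibleMap.

(** * The value function *)

Lemma inner_semicontinuous_near {R : realType} n m
    (S : 'rV[R]_n -> set 'rV[R]_m) xb yb e :
  inner_semicontinuous S xb yb -> 0 < e ->
  exists2 d, 0 < d & forall x, `|x - xb| < d ->
    exists2 y, S x y & `|y - yb| < e.
Proof.
move=> isc e0; apply: contrapT => H.
have /choice[u uP] : forall k : nat, exists x, `|x - xb| < k.+1%:R^-1 /\
    ~ (exists2 y, S x y & `|y - yb| < e).
  move=> k; apply: contrapT => Hk; apply: H.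
  exists k.+1%:R^-1; first by rewrite invr_gt0.
  by move=> x xk; apply: contrapT => Hy; apply: Hk; exists x.
have ucv : u @ \oo --> xb.
  apply/cvgrPdist_lt => d d0; near=> k.
  rewrite distrC (lt_trans (uP k).1) //.
  by near: k; exact: near_infty_natSinv_lt (PosNum d0).
have [v [Sv /cvgrPdist_lt/(_ e e0)[k _ vk]]] := isc u ucv.
apply: (uP k).2; exists (v k); first exact: Sv.
by rewrite distrC; apply: vk => /=.
Unshelve. all: by end_near. Qed.

Section ValueFunction.
Context {R : realType} {n m q : nat}.
Context {f : 'rV[R]_(n + m) -> R} {g : 'rV[R]_(n + m) -> 'rV[R]_q}.
Context {xb : 'rV[R]_n} {yb : 'rV[R]_m}.
Context (fC1 : C1 f).
Context (gC1 : C1 g).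
Context (gzb : feasible g (row_mx xb yb)).
Context (leb : local_error_bound g (row_mx xb yb)).
Context (CQ :
  [set lam *m (nabla_x g xb yb)^T | lam in Sigma0 g xb yb] = [set 0]).
Context (S_isc : inner_semicontinuous (Smap f g) xb yb).
Local Notation zb := (row_mx xb yb).
Local Notation V := (Vfun f g).

Lemma le_Vfun z : feasible g z -> ((f z)%:E <= V (lsubmx z))%E.
Proof.
move=> gz; apply: ereal_sup_ubound; exists (rsubmx z).
  by rewrite /Fmap /= hsubmxK.
by rewrite hsubmxK.
Qed.

(** In particular [V] is finite near [xb], so that [fine] loses nothing there. *)
Lemma near_solution e : 0 < e -> exists2 d, 0 < d &
  forall x, `|x - xb| < d -> exists z,
    [/\ feasible g z, lsubmx z = x, `|z - zb| < e & V x = (f z)%:E].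
Proof.
move=> e0; have e20 : 0 < e / 2 by rewrite divr_gt0.
have [d d0 H] := inner_semicontinuous_near S_isc e20.
exists (Num.min d (e / 2)); first by rewrite lt_min d0.
move=> x; rewrite lt_min => /andP[xd xe].
have [y [Fy fy] ye] := H x xd.
exists (row_mx x y); split; [exact: Fy|by rewrite row_mxKl| |by rewrite fy].
rewrite opp_row_mx add_row_mx (le_lt_trans (norm_row_mx_le _ _)) //.
by rewrite (splitr e) ltrD.
Qed.

(** A solution at [x] near [yb] is moved by [w] to a point that is feasible for
    [x + lsubmx w], where it bounds [V] from below. *)
Lemma value_increase e : 0 < e -> exists2 d, 0 < d & forall x w,
  `|x - xb| < d -> linearized_cone g zb w -> `|w| < d ->
  fine (V x) + dot (gradient f zb) w - e * `|w| <= fine (V (x + lsubmx w)).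
Proof.
move=> e0; pose G := (n + m)%:R * `|gradient f zb|.
have G0 : 0 <= G by rewrite mulr_ge0.
pose e1 := Num.min 1 (e / (2 * (G + 1))).
have G1 : 0 < 2 * (G + 1) by rewrite mulr_gt0 // ltr_wpDl.
have e10 : 0 < e1 by rewrite lt_min ltr01 divr_gt0.
have e11 : e1 <= 1 by rewrite ge_min lexx.
have e1e : e1 * (2 * (G + 1)) <= e.
  by rewrite -ler_pdivlMr // ge_min lexx orbT.
have e40 : 0 < e / 4 by rewrite divr_gt0.
have [dt dt0 tstep] := feasible_tangent_step gC1 gzb leb CQ e10.
have [df df0 fstr] := C1_strict zb fC1 e40.
have df30 : 0 < Num.min dt (df / 3) by rewrite lt_min dt0 divr_gt0.
have [dn dn0 sol] := near_solution df30.
have [dv dv0 fin] := near_solution ltr01.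
exists (Num.min (Num.min dn (dv / 2)) (Num.min (dv / 2) (Num.min dt (df / 3)))).
  by rewrite !lt_min dn0 dt0 !divr_gt0.
move=> x w; rewrite !lt_min => /andP[/andP[xn xv] _] wl.
move=> /andP[_ /andP[wv /andP[wt wf]]].
have [z [gz zx + ->]] := sol x xn; rewrite lt_min => /andP[zt zf] /=.
have [z' [gz' z'x z'E]] := tstep z w gz zt wl wt.
have Vx' : f z' <= fine (V (x + lsubmx w)).
  have xwv : `|x + lsubmx w - xb| < dv.
    rewrite addrAC (le_lt_trans (ler_normD _ _)) // (splitr dv) ltrD //.
    exact: le_lt_trans (norm_lsubmx_le _) wv.
  have [z2 [_ _ _ VE]] := fin _ xwv.
  by have := le_Vfun gz'; rewrite z'x zx VE lee_fin.
have z'w : `|z' - (z + w)| <= `|w| by rewrite (le_trans z'E) // ler_piMl.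
have zz' : `|z' - z| <= 2 * `|w|.
  have -> : z' - z = (z' - (z + w)) + w by rewrite opprD addrA subrK.
  by rewrite (le_trans (ler_normD _ _)) //; lra.
have z'd : `|z' - zb| < df.
  have -> : z' - zb = (z' - z) + (z - zb) by rewrite addrA subrK.
  by rewrite (le_lt_trans (ler_normD _ _)) //; lra.
have zd : `|z - zb| < df by lra.
have := fstr z' z z'd zd; rewrite ler_norml => /andP[+ _].
have -> : dot (gradient f zb) (z' - z)
    = dot (gradient f zb) (z' - (z + w)) + dot (gradient f zb) w.
  by rewrite -dotDr opprD addrA subrK.
have := norm_dot_le (gradient f zb) (z' - (z + w)).
rewrite ler_norml => /andP[+ _]; rewrite mulrA -/G => h1.
have h2 : G * `|z' - (z + w)| <= G * (e1 * `|w|) by rewrite ler_wpM2l.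
have h3 : e1 * (2 * (G + 1)) * `|w| <= e * `|w| by rewrite ler_wpM2r.
have h4 : e / 4 * `|z' - z| <= e / 4 * (2 * `|w|) by rewrite ler_pM2l.
have h5 : 0 <= e1 * `|w| by rewrite mulr_ge0 // ltW.
lra.
Qed.

(** Every displacement lifts to a direction of the linearized cone, and
    [value_increase] applies from either of two points to the other. *)
Lemma value_lipschitz : exists d L, [/\ 0 < d, 0 < L & forall x x',
  `|x - xb| < d -> `|x' - xb| < d ->
  fine (V x) - fine (V x') <= L * `|x - x'| ].
Proof.
have [C C1' lift] := linearized_cone_lift_bounded gC1 gzb CQ.
have C0 : 0 < C by apply: lt_le_trans C1'.
have [d d0 H] := value_increase ltr01.
pose G := (n + m)%:R * `|gradient f zb|.
have G0 : 0 <= G by rewrite mulr_ge0.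
have dC : d / (2 * C) <= d.
  rewrite ler_pdivrMr ?mulr_gt0 // ler_peMr ?ltW //; lra.
exists (d / (2 * C)), ((G + 1) * C); split.
- by rewrite divr_gt0 // mulr_gt0.
- by rewrite mulr_gt0 // ltr_wpDl.
move=> x x' xd x'd; have [w wl [wx wC]] := lift (x' - x).
have x'x : `|x' - x| < d / C.
  have -> : x' - x = (x' - xb) - (x - xb) by rewrite opprB addrA subrK.
  rewrite (le_lt_trans (ler_normB _ _)) //.
  have -> : d / C = d / (2 * C) + d / (2 * C).
    by field; exact: lt0r_neq0.
  exact: ltrD.
have wd : `|w| < d by rewrite (le_lt_trans wC) // mulrC -ltr_pdivlMr.
have := H x w (lt_le_trans xd dC) wl wd; rewrite wx (addrC x) subrK.
have := norm_dot_le (gradient f zb) w; rewrite ler_norml => /andP[+ _].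
rewrite mulrA -/G (distrC x).
have : (G + 1) * `|w| <= (G + 1) * (C * `|x' - x|).
  by rewrite ler_wpM2l // addr_ge0.
lra.
Qed.

End ValueFunction.

(** * Minimising a Lipschitz function over a closed set *)

Section Decoupling.
Context {R : realType} {n : nat}.

Lemma dot_self_continuous : continuous (fun u : 'rV[R]_n => dot u u).
Proof.
have -> : (fun u : 'rV[R]_n => dot u u)
        = \sum_(i < n) (fun u : 'rV[R]_n => u 0 i * u 0 i).
  by apply/funext => u; rewrite fct_sumE.
move=> u; apply: differentiable_continuous; apply: differentiable_sum => i.
by apply: differentiableM; exact: differentiable_coord.
Qed.

Lemma sqr_norm_le_dot (u : 'rV[R]_n) : `|u| ^+ 2 <= dot u u.
Proof.
rewrite -[leRHS]sqr_sqrtr ?dot_ge0 // ler_sqr ?nnegrE ?sqrtr_ge0 //.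
exact: norm_le_enorm.
Qed.

Lemma bounded_seq_cluster (B : R) (p : nat -> 'rV[R]_n) :
  (forall k, `|p k| <= B) -> exists p0 : 'rV[R]_n, forall e N, 0 < e ->
    exists2 k, (N <= k)%N & `|p k - p0| < e.
Proof.
move=> pB; have cA := @compact_closed_ball_inter _ n setT 0 B closedT.
have [|p0 [_ clp0]] := cA (p @ \oo) _.
  by exists 0%N => // k _; split=> //=; rewrite subr0.
exists p0 => e N e0.
have [|_ [[k /= Nk <-] ek]] :=
    clp0 (p @` [set k | (N <= k)%N]) (ball p0 e) _ (nbhsx_ballx p0 e e0).
  by exists N => // k /= Nk; exists k.
by exists k => //; move: ek; rewrite -ball_normE /= distrC.
Qed.

Context (v : 'rV[R]_n -> R) (X : set 'rV[R]_n) (xb : 'rV[R]_n) (d0 L : R).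
Context (cX : closed X) (Xxb : X xb) (d00 : 0 < d0) (L0 : 0 < L).
Context (v_lip : forall x x', `|x - xb| < d0 -> `|x' - xb| < d0 ->
  v x - v x' <= L * `|x - x'|).
Context (v_min : forall x, X x -> `|x - xb| < d0 -> v xb <= v x).

Lemma penalized_minimizer (K : R) : 0 < K -> exists x x',
  [/\ X x, `|x - xb| <= d0 / 2, `|x' - xb| <= d0 / 2 &
   forall y y', X y -> `|y - xb| <= d0 / 2 -> `|y' - xb| <= d0 / 2 ->
     v x' + K * dot (x - x') (x - x') + dot (x - xb) (x - xb) <=
     v y' + K * dot (y - y') (y - y') + dot (y - xb) (y - xb)].
Proof.
move=> K0; set r := d0 / 2.
have r0 : 0 <= r by rewrite divr_ge0 // ltW.
have rd0 : r < d0 by have := d00; rewrite /r; lra.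
pose F := lsubmx @^-1` X : set 'rV[R]_(n + n).
have cF : closed F by apply: closed_comp => // z _; exact: continuous_lsubmx.
pose psi (z : 'rV[R]_(n + n)) := v (rsubmx z) +
  K * dot (lsubmx z - rsubmx z) (lsubmx z - rsubmx z)
  + dot (lsubmx z - xb) (lsubmx z - xb).
have ballE (y y' : 'rV[R]_n) : `|y - xb| <= r -> `|y' - xb| <= r ->
    `|row_mx y y' - row_mx xb xb| <= r.
  rewrite opp_row_mx add_row_mx => yr y'r; apply: norm_le_coord => // i.
  rewrite -(splitK i); case: (fintype.split i) => j /=.
    by rewrite row_mxEl (le_trans (coord_le_norm _ _)).
  by rewrite row_mxEr (le_trans (coord_le_norm _ _)).
have lball (z : 'rV[R]_(n + n)) :
    `|z - row_mx xb xb| <= r -> `|lsubmx z - xb| <= r.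
  move=> zr; have -> : lsubmx z - xb = lsubmx (z - row_mx xb xb).
    by rewrite linearB /= row_mxKl.
  exact: le_trans (norm_lsubmx_le _) zr.
have rball (z : 'rV[R]_(n + n)) :
    `|z - row_mx xb xb| <= r -> `|rsubmx z - xb| <= r.
  move=> zr; have -> : rsubmx z - xb = rsubmx (z - row_mx xb xb).
    by rewrite linearB /= row_mxKr.
  apply: le_trans zr; apply: norm_le_coord => // i.
  by rewrite mxE coord_le_norm.
have cpsi : {within F `&` [set z | `|z - row_mx xb xb| <= r], continuous psi}.
  apply: continuous_in_subspaceT => z; rewrite inE => -[_ /rball zr].
  have cv : {for rsubmx z, continuous v}.
    move=> A /nbhs_normP[e /= e0 eA].
    apply/(nbhs_normP (rsubmx z) (v @^-1` A)).
    exists (Num.min (d0 - r) (e / L)) => /=.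
      by rewrite lt_min subr_gt0 rd0 divr_gt0.
    move=> y /=; rewrite lt_min => /andP[yd ye]; apply: eA => /=.
    have yb : `|y - xb| < d0.
      rewrite -(subrK (rsubmx z) y) -addrA (le_lt_trans (ler_normD _ _)) //.
      by rewrite distrC; lra.
    have zb : `|rsubmx z - xb| < d0 by apply: le_lt_trans rd0.
    rewrite ltr_pdivlMr // mulrC in ye.
    rewrite ltr_norml; apply/andP; split.
      by have := v_lip yb zb; rewrite (distrC y); lra.
    by have := v_lip zb yb; lra.
  have c1 : {for z, continuous (fun z : 'rV[R]_(n + n) => v (rsubmx z))}.
    by apply: continuous_comp cv; exact: continuous_rsubmx.
  have c2 : {for z, continuous (fun z : 'rV[R]_(n + n) =>
      dot (lsubmx z - rsubmx z) (lsubmx z - rsubmx z))}.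
    apply: (@continuous_comp _ _ _ (fun z : 'rV[R]_(n + n) => lsubmx z - rsubmx z)
      (fun u => dot u u)); last exact: dot_self_continuous.
    exact: (cvgB (@continuous_lsubmx _ _ _ _ z) (@continuous_rsubmx _ _ _ _ z)).
  have c3 : {for z, continuous (fun z : 'rV[R]_(n + n) =>
      dot (lsubmx z - xb) (lsubmx z - xb))}.
    apply: (@continuous_comp _ _ _ (fun z : 'rV[R]_(n + n) => lsubmx z - xb)
      (fun u => dot u u)); last exact: dot_self_continuous.
    exact: (cvgB (@continuous_lsubmx _ _ _ _ z) (cvg_cst xb)).
  exact: (cvgD (cvgD c1 (cvgM (cvg_cst K) c2)) c3).
have [|z] :=
  EVT_min_rV _ (@compact_closed_ball_inter _ _ F (row_mx xb xb) r cF) cpsi.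
  exists (row_mx xb xb); split; first by rewrite /F /= row_mxKl.
  by rewrite /= subrr normr0.
rewrite inE => -[Fz zr] zmin; exists (lsubmx z), (rsubmx z); split=> //.
- exact: lball.
- exact: rball.
move=> y y' Xy yr y'r; have := zmin (row_mx y y').
rewrite /psi row_mxKl row_mxKr; apply; rewrite inE; split.
  by rewrite /F /= row_mxKl.
exact: ballE.
Qed.

(** At a penalised minimiser [(x, x')] with parameter [K], the two partial
    minimality conditions say that [p = 2 K (x - x')] is, up to sign and to
    the vanishing term [2 (x - xb)], a normal of [X] at [x], and a slope
    supporting [v] from below at [x'].  The Lipschitz bound gives
    [K|x - x'| <= L] and [|x - xb|^2 <= L|x - x'|], whence the bound on [p] and
    the convergence of both points. *)
Lemma approximate_critical_pair (eta : R) : 0 < eta -> exists x x' p,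
  [/\ X x /\ `|x - xb| < eta, `|x' - xb| < eta, `|p| <= 2 * L,
      regular_normal_cone X x (- (p + 2 *: (x - xb))) &
      exists K d, [/\ 0 < K, 0 < d & forall h, `|h| < d ->
        v x' - dot p h - K * dot h h <= v (x' - h)]].
Proof.
have d0p := d00; move=> eta0; pose s := Num.min (eta / 4) (d0 / 8).
have s0 : 0 < s by rewrite lt_min !divr_gt0.
have seta : s <= eta / 4 by rewrite ge_min lexx.
have sd0 : s <= d0 / 8 by rewrite ge_min lexx orbT.
(* The two terms make |x - x'| and |x - xb| at most s, respectively. *)
pose K := L / s + (L / s) ^+ 2 + 1.
have K0 : 0 < K by rewrite ltr_wpDl // addr_ge0 ?sqr_ge0 // divr_ge0 // ltW.
have KLs : L <= K * s.
  by rewrite -ler_pdivrMr // /K -addrA lerDl addr_ge0 // sqr_ge0.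
have KL2 : L ^+ 2 <= K * s ^+ 2.
  rewrite -ler_pdivrMr ?exprn_gt0 // -expr_div_n /K.
  by rewrite addrAC lerDr addr_ge0 // divr_ge0 // ltW.
clearbody K.
have [x [x' [Xx xr x'r xmin]]] := penalized_minimizer K0.
have lt_r y : `|y - xb| <= d0 / 2 -> `|y - xb| < d0.
  by move=> /le_lt_trans; apply; rewrite ltr_pdivrMr // ltr_pMr // ltr1n.
(* Minimality against the pair (xb, xb). *)
have gap : K * dot (x - x') (x - x') + dot (x - xb) (x - xb) <= L * `|x - x'|.
  have bb : `|xb - xb| <= d0 / 2 by rewrite subrr normr0 divr_ge0 // ltW.
  have := xmin xb xb Xxb bb bb; rewrite subrr dot0l mulr0 !addr0.
  have := v_lip (lt_r _ xr) (lt_r _ x'r).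
  have := v_min Xx (lt_r _ xr); lra.
have Kxx' : K * `|x - x'| <= L.
  have [->|xx'0] := eqVneq (x - x') 0; first by rewrite normr0 mulr0 ltW.
  have xx'p : 0 < `|x - x'| by rewrite normr_gt0.
  rewrite -(ler_pM2r xx'p) -mulrA -expr2.
  apply: le_trans gap; rewrite ler_wpDr ?dot_ge0 // ler_pM2l //.
  exact: sqr_norm_le_dot.
have xx's : `|x - x'| <= s.
  by rewrite -(ler_pM2l K0) (le_trans Kxx').
have xs : `|x - xb| <= s.
  rewrite -ler_sqr ?nnegrE ?(ltW s0) // (le_trans (sqr_norm_le_dot _)) //.
  have : dot (x - xb) (x - xb) <= L * `|x - x'|.
    by apply: le_trans gap; rewrite lerDr mulr_ge0 ?dot_ge0 // ltW.
  move=> /le_trans; apply; rewrite -(ler_pM2l K0); apply: le_trans KL2.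
  by rewrite mulrCA expr2 ler_pM2l.
have x's : `|x' - xb| <= 2 * s.
  rewrite -(subrK x x') -addrA (le_trans (ler_normD _ _)) // distrC.
  by rewrite mulr2n mulrDl mul1r lerD.
exists x, x', ((2 * K) *: (x - x')); split.
- split=> //; lra.
- by rewrite (le_lt_trans x's) //; lra.
- by rewrite normrZ gtr0_norm ?mulr_gt0 // -mulrA ler_pM2l.
- move=> eps eps0.
  have d10 : 0 < Num.min (d0 / 4) (eps / ((K + 1) * n.+1%:R)).
    by rewrite lt_min !divr_gt0 // mulr_gt0 // addr_gt0.
  apply/nbhs_normP; exists (Num.min (d0 / 4) (eps / ((K + 1) * n.+1%:R))) => //.
  move=> y /=; rewrite distrC lt_min => /andP[yd ye] Xy.
  have yr : `|y - xb| <= d0 / 2.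
    rewrite -(subrK x y) -addrA (le_trans (ler_normD _ _)) //; lra.
  have := xmin y x' Xy yr x'r.
  set h := y - x in yd ye *.
  have -> : y - x' = (x - x') + h by rewrite [RHS]addrC /h addrA subrK.
  have -> : y - xb = (x - xb) + h by rewrite [RHS]addrC /h addrA subrK.
  move: (x - x') (x - xb) => a b; clearbody h.
  rewrite !(dotDl, dotDr, dotNl, dotZl) (dotC h a) (dotC h b) => xm.
  have hh : (K + 1) * dot h h <= eps * enorm h.
    have -> : dot h h = enorm h * enorm h by rewrite -expr2 sqr_sqrtr ?dot_ge0.
    rewrite mulrA ler_wpM2r ?sqrtr_ge0 //.
    rewrite ltr_pdivlMr ?mulr_gt0 ?addr_gt0 // in ye.
    apply: le_trans (ltW ye); rewrite [leRHS]mulrCA.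
    by rewrite ler_pM2l ?addr_gt0 // mulrC enorm_le_norm.
  lra.
exists K, (d0 / 4); split; rewrite ?divr_gt0 // => h hd.
have x'hr : `|x' - h - xb| <= d0 / 2.
  by rewrite addrAC (le_trans (ler_normB _ _)) //; lra.
have := xmin x (x' - h) Xx xr x'hr.
have -> : x - (x' - h) = (x - x') + h by rewrite opprB addrA addrAC.
move: (x - x') (x - xb) => a b.
rewrite !(dotDl, dotDr, dotZl) (dotC h a); lra.
Qed.

(** The slopes [p] of the approximate pairs are bounded, hence cluster.  At
    [x'] the support inequality bounds [v x' - v (x' - t *: u)] from above by
    [t * dot p u + O(t^2)], while the estimate assumed for [u], started from
    [x' - t *: u], bounds it from below by [t * (c - e)]. *)
Lemma limiting_critical_point : exists2 p,
  limiting_normal_cone X xb (- p) & forall u c,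
    (forall e, 0 < e -> exists2 d, 0 < d & forall x t,
       `|x - xb| < d -> 0 < t -> t < d ->
       v x + t * (c - e) <= v (x + t *: u)) ->
    c <= dot p u.
Proof.
have /choice[x xP] : forall k : nat, exists x, exists x' p,
  [/\ X x /\ `|x - xb| < k.+1%:R^-1, `|x' - xb| < k.+1%:R^-1, `|p| <= 2 * L,
      regular_normal_cone X x (- (p + 2 *: (x - xb))) &
      exists K d, [/\ 0 < K, 0 < d & forall h, `|h| < d ->
        v x' - dot p h - K * dot h h <= v (x' - h)]].
  by move=> k; apply: approximate_critical_pair; rewrite invr_gt0.
move: xP => /choice[x' /choice[p pP]].
have pB k : `|p k| <= 2 * L by case: (pP k).
have [p0 p0P] := bounded_seq_cluster pB.
have /choice[s sP] : forall j : nat, exists k, (j <= k)%N /\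
    `|p k - p0| < j.+1%:R^-1.
  by move=> j; have [|k] := p0P j.+1%:R^-1 j; [rewrite invr_gt0|exists k].
have small (j : nat) : (s j).+1%:R^-1 <= j.+1%:R^-1 :> R.
  by rewrite lef_pV2 ?posrE // ler_nat ltnS; case: (sP j).
have xcv : x \o s @ \oo --> xb.
  apply/cvgrPdist_lt => e e0; near=> j.
  rewrite distrC /=; have [[_ xs] _ _ _ _] := pP (s j).
  rewrite (lt_le_trans xs) // (le_trans (small j)) // ltW //.
  by near: j; exact: near_infty_natSinv_lt (PosNum e0).
have pcv : p \o s @ \oo --> p0.
  apply/cvgrPdist_lt => e e0; near=> j.
  rewrite distrC /= (lt_trans (sP j).2) //.
  by near: j; exact: near_infty_natSinv_lt (PosNum e0).
exists p0.
  exists (x \o s), (fun j => - (p (s j) + 2 *: (x (s j) - xb))); split=> //.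
  - by move=> j /=; have [[]] := pP (s j).
  - by move=> j /=; have [_ _ _] := pP (s j).
  have -> : - p0 = - (p0 + 2 *: (xb - xb)) by rewrite subrr scaler0 addr0.
  exact: (cvgN (cvgD pcv (cvgZ (cvg_cst (2 : R)) (cvgB xcv (cvg_cst xb))))).
move=> u c cP; rewrite leNgt; apply/negP => lt_c.
pose e := (c - dot p0 u) / 4.
have e0 : 0 < e by rewrite divr_gt0 // subr_gt0.
have eE : c = dot p0 u + 4 * e by rewrite /e; lra.
clearbody e.
have [d d1 dP] := cP e e0.
pose N := n%:R * `|u| : R.
have N0 : 0 <= N by rewrite mulr_ge0.
have m0 : 0 < Num.min (d / 2) (e / (N + 1)).
  by rewrite lt_min !divr_gt0 // ltr_wpDl.
have [j _ jP] := near_infty_natSinv_lt (PosNum m0).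
have := jP j (leqnn j); rewrite /= lt_min => /andP[jd je].
have [_ x's _ _ [K [dK [K0 dK0 vK]]]] := pP (s j).
have {}x's : `|x' (s j) - xb| < d / 2.
  by rewrite (lt_trans (lt_le_trans x's (small j))).
have pu : dot (p (s j)) u <= dot p0 u + e.
  rewrite -lerBlDl -dotBl (le_trans (ler_norm _)) //.
  rewrite (le_trans (norm_dot_le _ _)) //.
  have pj : `|p (s j) - p0| <= e / (N + 1) by rewrite ltW // (lt_trans (sP j).2).
  rewrite mulrCA -/N; rewrite ler_pdivlMr ?ltr_wpDl // in pj.
  by apply: le_trans pj; rewrite ler_wpM2l // lerDl.
(* Small enough for x' - t u to stay in reach and for O(t) to be below e. *)
pose t := Num.min (Num.min (d / 2) (d / 2 / (`|u| + 1)))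
                  (Num.min (dK / (`|u| + 1)) (e / (K * dot u u + 1))).
have u1 : 0 < `|u| + 1 by rewrite ltr_wpDl.
have Ku1 : 0 < K * dot u u + 1 by rewrite ltr_wpDl // mulr_ge0 ?dot_ge0 // ltW.
have t0 : 0 < t by rewrite !lt_min !divr_gt0.
have td : t <= d / 2 by rewrite /t !ge_min lexx.
have tu : t * (`|u| + 1) <= d / 2.
  by rewrite -ler_pdivlMr // /t !ge_min lexx !orbT.
have tK : t * (`|u| + 1) <= dK.
  by rewrite -ler_pdivlMr // /t !ge_min lexx !orbT.
have te : t * (K * dot u u + 1) <= e.
  by rewrite -ler_pdivlMr // /t !ge_min lexx !orbT.
clearbody t.
have tun : `|t *: u| = t * `|u| by rewrite normrZ gtr0_norm.
have hK : `|t *: u| < dK by rewrite tun; lra.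
have hd : `|x' (s j) - t *: u - xb| < d.
  by rewrite addrAC (le_lt_trans (ler_normB _ _)) // tun; lra.
have td' : t < d by lra.
have := dP _ t hd t0 td'; rewrite subrK => h1.
have := vK _ hK; rewrite dotZr dotZl dotZr => h2.
have : t * (c - e) <= t * (dot (p (s j)) u + K * (t * dot u u)) by lra.
rewrite ler_pM2l // => h3.
have : K * (t * dot u u) <= e by lra.
lra.
Unshelve. all: by end_near. Qed.

End Decoupling.

(** * Stationarity *)

Lemma gradient_lagrangian {R : realType} N q (f : 'rV[R]_N -> R)
    (g : 'rV[R]_N -> 'rV[R]_q) (lam : 'rV[R]_q) z :
  C1 f -> C1 g -> gradient (fun z => f z - dot (g z) lam) z =
  gradient f z - \sum_j lam 0 j *: gradient (fun z => g z 0 j) z.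
Proof.
move=> [df _] gC1.
have dg v j : derivable (fun z => g z 0 j) z v.
  by apply: diff_derivable; have [] := C1_coord j gC1.
have -> : (fun z => f z - dot (g z) lam)
        = f - \sum_j (lam 0 j *: (fun z => g z 0 j)).
  apply/funext => t; rewrite !fctE fct_sumE; congr (_ - _).
  by apply: eq_bigr => j _; rewrite mulrC.
apply/rowP => i; rewrite !mxE summxE deriveB; first last.
- by apply: derivable_sum => j; exact: derivableZ.
- exact: diff_derivable.
congr (_ - _); rewrite derive_sum => [|j]; last exact: derivableZ.
by apply: eq_bigr => j _; rewrite deriveZ // !mxE.
Qed.

Unset Implicit Arguments.

Theorem theorem4p7 (R : realType) (n m q : nat)
    (f : 'rV[R]_(n + m) -> R) (g : 'rV[R]_(n + m) -> 'rV[R]_q)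
    (X : set 'rV[R]_n) (xb : 'rV[R]_n) (yb : 'rV[R]_m)
    (f_C1 : C1 f) (g_C1 : C1 g) (X_closed : closed X)
    (sol : minimax_local_solution f g X xb yb)
    (S_isc : inner_semicontinuous (Smap f g) xb yb)
    (leb : local_error_bound g (row_mx xb yb))
    (CQ : [set lam *m (nabla_x g xb yb)^T | lam in Sigma0 g xb yb]
          = [set 0]) :
  exists lamb : 'rV[R]_q,
    [/\ [set gradient (fun x => Lagrangian f g x yb lamb) xb + xi
          | xi in limiting_normal_cone X xb] 0,
        gradient (fun y => Lagrangian f g xb y lamb) yb = 0 &
        complementary (- g (row_mx xb yb)) lamb].
Proof.
have [[Xxb /nbhs_normP[dm /= dm0 Vmin]] [gzb _]] := sol.
set zb := row_mx xb yb in leb gzb *.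
have [dL [L [dL0 L0 vlip]]] := value_lipschitz f_C1 g_C1 gzb leb CQ S_isc.
have [df df0 Vfin] := near_solution S_isc (@ltr01 R).
pose d0 := Num.min dL (Num.min df dm).
have d00 : 0 < d0 by rewrite !lt_min dL0 df0.
have vlip0 x x' : `|x - xb| < d0 -> `|x' - xb| < d0 ->
    fine (Vfun f g x) - fine (Vfun f g x') <= L * `|x - x'|.
  by rewrite !lt_min => /andP[xd _] /andP[x'd _]; exact: vlip.
have vmin0 x : X x -> `|x - xb| < d0 ->
    fine (Vfun f g xb) <= fine (Vfun f g x).
  rewrite !lt_min => Xx /and3P[_ xdf xdm].
  have := Vmin x; rewrite /ball_ /= distrC => /(_ xdm Xx).
  have [z [_ _ _ ->]] := Vfin x xdf.
  have [|z' [_ _ _ ->]] := Vfin xb; first by rewrite subrr normr0.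
  by rewrite lee_fin.
have [p Np pmax] := limiting_critical_point X_closed Xxb d00 L0 vlip0 vmin0.
have grad_le w : linearized_cone g zb w ->
    dot (gradient f zb) w <= dot p (lsubmx w).
  move=> wl; apply: pmax => e e0.
  have w1 : 0 < `|w| + 1 by rewrite ltr_wpDl.
  have [d d_gt0 incr] :=
    value_increase f_C1 g_C1 gzb leb CQ S_isc (divr_gt0 e0 w1).
  exists (Num.min d (d / (`|w| + 1))); first by rewrite lt_min d_gt0 divr_gt0.
  move=> x t; rewrite !lt_min => /andP[xd _] t0 /andP[_ tw].
  rewrite ltr_pdivlMr // in tw.
  have twn : `|t *: w| = t * `|w| by rewrite normrZ gtr0_norm.
  have twl : linearized_cone g zb (t *: w).
    by move=> j gj; rewrite dotZr pmulr_rle0 // wl.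
  have twd : `|t *: w| < d by rewrite twn; lra.
  have tl : lsubmx (t *: w) = t *: lsubmx w by rewrite linearZ.
  have := incr x _ xd twl twd; rewrite dotZr tl.
  move=> /(le_trans _); apply.
  rewrite mulrBr addrA lerB // twn mulrCA ler_pM2l //.
  by rewrite -mulrA ler_piMr ?(ltW e0) // ler_pdivrMl // mulr1 lerDl.
(* The bound on the cone is the failure of the second Farkas alternative. *)
have [[l [l0 lA gradE]]|[w wl]] := farkas_on (fun j => g zb 0 j == 0)
    (fun j => gradient (fun z => g z 0 j) zb) (gradient f zb - row_mx p 0);
    last first.
  rewrite dotBl -{2}(hsubmxK w) dot_row_mx dot0l addr0 subr_gt0 ltNge.
  by rewrite grad_le // => j gj; apply: wl; rewrite gj.
have gradL : gradient (fun z => f z - dot (g z) l) zb = row_mx p 0.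
  by rewrite gradient_lagrangian // -gradE opprB addrCA subrr addr0.
exists l; split; last exact: complementary_active.
- exists (- p) => //.
  rewrite (gradient_lsub (fun z => f z - dot (g z) l)) gradL row_mxKl.
  exact: subrr.
- by rewrite (gradient_rsub (fun z => f z - dot (g z) l)) gradL row_mxKr.
Qed.
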